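(* Let $A$ be a complex antidiagonal matrix of size $n$ in standard form with entries $a_1,\dots,a_n$, and let $A=PQP^{-1}$ be its permutation-quasidiagonalization, with $P$, $Q$ as described in the context. (a) $A$ is symmetric if and only if $Q$ is symmetric. (b) $A$ is antisymmetric if and only if $Q$ is antisymmetric. (c) If $A$ is real and antisymmetric, then $A=PQP^{-1}$ is a real Schur decomposition of $A$, and $Q$ is the real Schur form of $A$.
   Context: An antidiagonal matrix has nonzero entries only at positions $(i,n+1-i)$. Standard form and the matrices $P,Q$: For $n=2m$: $A_{m+1-j,\,m+j}=a_{2j-1}$, $A_{m+j,\,m+1-j}=a_{2j}$ ($1\le j\le m$); $P$ is the permutation matrix with $P_{m+1-j,\,2j-1}=1$, $P_{m+j,\,2j}=1$ ($1\le j\le m$); $Q=\bigoplus_{j=1}^m\begin{pmatrix}0 & a_{2j-1} \\ a_{2j} & 0\end{pmatrix}$. For $n=2m+1$: $A_{m+1,m+1}=a_1$, $A_{m+1-j,\,m+1+j}=a_{2j+1}$, $A_{m+1+j,\,m+1-j}=a_{2j}$ ($1\le j\le m$); $P$ is the permutation matrix with $P_{m+1,1}=1$, $P_{m+1-j,\,2j}=1$, $P_{m+1+j,\,2j+1}=1$ ($1\le j\le m$); $Q=(a_1)\oplus\bigoplus_{j=1}^m\begin{pmatrix}0 & a_{2j+1} \\ a_{2j} & 0\end{pmatrix}$. One has $A=PQP^{-1}$. A real Schur decomposition of a real matrix $M$ is a decomposition $M=RTR^{-1}$ with $R$ real orthogonal and $T$ (the real Schur form) a real block upper triangular matrix whose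 diagonal blocks have size $1$, or size $2$ with complex conjugate eigenvalues. *)

(* Defs.v *)
From HB Require Import structures.
From mathcomp Require Import all_boot all_order all_algebra.
From mathcomp Require Import sesquilinear spectral.
From mathcomp Require Import complex reals.

Set Implicit Arguments.
Unset Strict Implicit.
Unset Printing Implicit Defensive.

Import Order.TTheory GRing.Theory Num.Theory.
Local Open Scope ring_scope.

Section StandardForm.
Context {R : realType}.
Local Notation C := R[i].

(* Rows, columns and the entries a_1, ..., a_n are numbered from 1, so that the
   formulas below are the usual ones: [elt_mx n i j] has its 1 in row i and
   column j for 1 <= i, j <= n, and the value of [a] matters only at 1, ..., n.
   All natural-number subtractions below are exact. *)
Definition elt_mx (n i j : nat) : 'M[C]_n :=
  \matrix_(k < n, l < n) ((k.+1 == i) && (l.+1 == j))%:R.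

(* n = 2m or n = 2m + 1, with m = n./2. *)
Definition antidiag_mx (n : nat) (a : nat -> C) : 'M[C]_n :=
  let m := n./2 in
  if odd n then
    a 1 *: elt_mx n (m + 1) (m + 1)
    + \sum_(1 <= j < m.+1)
        (a (2 * j + 1)%N *: elt_mx n (m + 1 - j) (m + 1 + j)
         + a (2 * j)%N *: elt_mx n (m + 1 + j) (m + 1 - j))
  else
    \sum_(1 <= j < m.+1)
      (a (2 * j - 1)%N *: elt_mx n (m + 1 - j) (m + j)
       + a (2 * j)%N *: elt_mx n (m + j) (m + 1 - j)).

Definition stdperm_mx (n : nat) : 'M[C]_n :=
  let m := n./2 in
  if odd n then
    elt_mx n (m + 1) 1
    + \sum_(1 <= j < m.+1)
        (elt_mx n (m + 1 - j) (2 * j) + elt_mx n (m + 1 + j) (2 * j + 1))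
  else
    \sum_(1 <= j < m.+1)
      (elt_mx n (m + 1 - j) (2 * j - 1) + elt_mx n (m + j) (2 * j)).

(* The direct sum of 2 x 2 blocks: for n even the j-th block occupies rows and
   columns 2j - 1 and 2j; for n odd it is preceded by the 1 x 1 block (a_1) and
   occupies rows and columns 2j and 2j + 1. *)
Definition quasidiag_mx (n : nat) (a : nat -> C) : 'M[C]_n :=
  let m := n./2 in
  if odd n then
    a 1 *: elt_mx n 1 1
    + \sum_(1 <= j < m.+1)
        (a (2 * j + 1)%N *: elt_mx n (2 * j) (2 * j + 1)
         + a (2 * j)%N *: elt_mx n (2 * j + 1) (2 * j))
  else
    \sum_(1 <= j < m.+1)
      (a (2 * j - 1)%N *: elt_mx n (2 * j - 1) (2 * j)
       + a (2 * j)%N *: elt_mx n (2 * j) (2 * j - 1)).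

End StandardForm.

Section RealSchur.
Context {R : realType}.
Local Notation C := R[i].

(* The pair is required to be non-real: a 2 x 2 block with real eigenvalues,
   even equal ones, is not allowed. *)
Definition conj_eigenvalues (B : 'M[C]_2) : Prop :=
  exists l : C, [/\ l \isn't Num.real, eigenvalue B l & eigenvalue B (Num.conj l)].

Inductive quasi_triangular : forall n : nat, 'M[C]_n -> Prop :=
| QuasiTriangular0 (T : 'M[C]_0) : quasi_triangular T
| QuasiTriangular1 (n : nat) (t : 'M[C]_1) (u : 'M[C]_(1, n)) (T : 'M[C]_n) :
    quasi_triangular T ->
    @quasi_triangular (1 + n) (block_mx t u 0 T)
| QuasiTriangular2 (n : nat) (B : 'M[C]_2) (u : 'M[C]_(2, n)) (T : 'M[C]_n) :
    conj_eigenvalues B -> quasi_triangular T ->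
    @quasi_triangular (2 + n) (block_mx B u 0 T).

Definition real_schur_form (n : nat) (T : 'M[C]_n) : Prop :=
  T \is a realmx /\ quasi_triangular T.

Definition real_orthogonal (n : nat) (U : 'M[C]_n) : Prop :=
  U \is a realmx /\ U *m U^T = 1%:M.

Definition real_schur_decomposition (n : nat) (M U T : 'M[C]_n) : Prop :=
  [/\ M \is a realmx, real_orthogonal U, real_schur_form T
    & M = U *m T *m invmx U].

End RealSchur.

(* Main.v *)
Require Import Defs.
From HB Require Import structures.
From mathcomp Require Import all_boot all_order all_algebra.
From mathcomp Require Import sesquilinear spectral.
From mathcomp Require Import complex reals.
From mathcomp Require Import fingroup perm zify.

(** P is the permutation matrix of s : 'S_n, and Q is A with rows and columns
    renumbered by s, so that A = P Q P^T and (anti)symmetry passes between A and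
    Q. A real antisymmetric 2 x 2 block has eigenvalues +-ic for a real c: it is a
    legitimate block of a real Schur form when c <> 0, and otherwise it is zero and
    splits into two blocks of size 1. *)

Set Implicit Arguments.
Unset Strict Implicit.
Unset Printing Implicit Defensive.

Import Order.TTheory GRing.Theory Num.Theory.
Local Open Scope ring_scope.

(** * The order in which the columns of P reach the rows *)

Section StandardPermutation.
Local Open Scope nat_scope.

(* The row, numbered from 1, of the entry 1 in column k of [stdperm_mx n]. *)
Definition stdpos (n k : nat) : nat :=
  if odd k == odd n then uphalf n + k./2 else uphalf n - k./2.

Lemma stdpos_range n k : 0 < k <= n -> 0 < stdpos n k <= n.
Proof. rewrite /stdpos; case: eqP; lia. Qed.

(** As [k] runs from 1 to [n], [stdpos n k] moves outward from the centre on alternating sides: the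
    side gives the parity of [k], the distance gives [k./2]. The bound [0 < k] matters: for even
    [n], the values at 0 and 1 coincide. *)
Lemma stdpos_inj n k l :
  0 < k <= n -> 0 < l <= n -> stdpos n k = stdpos n l -> k = l.
Proof. rewrite /stdpos; do 2 case: eqP; lia. Qed.

Lemma stdpos_pred_lt n (k : 'I_n) : (stdpos n k.+1).-1 < n.
Proof. have := @stdpos_range n k.+1 (ltn_ord k); lia. Qed.

Definition stdpos_ord n (k : 'I_n) : 'I_n := Ordinal (stdpos_pred_lt k).

Lemma stdpos_ordE n (k : 'I_n) : (stdpos_ord k).+1 = stdpos n k.+1.
Proof. by have := @stdpos_range n k.+1 (ltn_ord k); rewrite /=; lia. Qed.

Lemma stdpos_ord_inj n : injective (@stdpos_ord n).
Proof.
move=> k l /(congr1 (fun i : 'I_n => i.+1)); rewrite !stdpos_ordE.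
by move/(@stdpos_inj n k.+1 l.+1 (ltn_ord k) (ltn_ord l)) => [] /val_inj.
Qed.

Definition stdperm n : 'S_n := perm (@stdpos_ord_inj n).

Lemma stdpermE n (k : 'I_n) : (stdperm n k).+1 = stdpos n k.+1.
Proof. by rewrite permE stdpos_ordE. Qed.

End StandardPermutation.

(** * Conjugation by the permutation matrix *)

Section PermutationMatrices.
Context {R : realType}.
Local Notation C := R[i].

Lemma addmxE n (M N : 'M[C]_n) k l : (M + N) k l = M k l + N k l.
Proof. by rewrite mxE. Qed.

Lemma scalemxE n (x : C) (M : 'M[C]_n) k l : (x *: M) k l = x * M k l.
Proof. by rewrite mxE. Qed.

Lemma sum_nat_pairs (V : nmodType) m (F : nat -> V) :
  \sum_(1 <= k < m.*2.+1) F k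
  = \sum_(1 <= j < m.+1) (F (2 * j - 1)%N + F (2 * j)%N).
Proof.
elim: m => [|m IHm]; first by rewrite !big_nil.
rewrite doubleS 2?big_nat_recr // IHm [RHS]big_nat_recr //= -addrA.
by congr (_ + (F _ + F _)); lia.
Qed.

Lemma stdperm_mx_sum n :
  stdperm_mx n = \sum_(1 <= k < n.+1) elt_mx n (stdpos n k) k :> 'M[C]_n.
Proof.
have nE := odd_double_half n; rewrite /stdperm_mx.
(* The bound [p] is kept apart from [n], so that expanding [n] by parity changes the range of the
   sum but not the type of the matrices. *)
pose G p : 'M[C]_n := \sum_(1 <= k < p.+1) elt_mx n (stdpos n k) k.
case: ifP nE => odd_n; last first.
  rewrite add0n => nE; rewrite -[RHS](congr1 G nE) /G sum_nat_pairs.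
  apply: eq_big_nat => j /andP[j_gt0 j_le].
  by congr (elt_mx _ _ _ + elt_mx _ _ _); rewrite /stdpos; case: eqP; lia.
rewrite add1n => nE; rewrite -[RHS](congr1 G nE) /G [RHS]big_nat_recl //.
congr (_ + _); first by congr (elt_mx _ _ _); rewrite /stdpos odd_n /=; lia.
rewrite (sum_nat_pairs _ (fun k => elt_mx n (stdpos n k.+1) k.+1)).
apply: eq_big_nat => j /andP[j_gt0 j_le].
by congr (elt_mx _ _ _ + elt_mx _ _ _); rewrite /stdpos; try case: eqP; lia.
Qed.

(** The transpose appears because [perm_mx s] has its ones at [(k, s k)], while those of P are at
    [(s k, k)]. *)
Lemma stdperm_mxE n : stdperm_mx n = (perm_mx (stdperm n))^T :> 'M[C]_n.
Proof.
rewrite stdperm_mx_sum big_add1 /= big_mkord; apply/matrixP => k l.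
rewrite summxE (bigD1 l) //= big1 => [|i i_neq_l]; last first.
  by rewrite mxE andbC eqSS val_eqE eq_sym (negPf i_neq_l).
by rewrite !mxE eqxx andbT addr0 -stdpermE eqSS val_eqE eq_sym.
Qed.

Lemma elt_mx_stdperm n x y (k l : 'I_n) :
  (0 < x <= n)%N -> (0 < y <= n)%N ->
  elt_mx n (stdpos n x) (stdpos n y) (stdperm n k) (stdperm n l)
  = elt_mx n x y k l :> C.
Proof.
move=> x_range y_range; rewrite !mxE !stdpermE.
have stdpos_eq (i : 'I_n) z :
    (0 < z <= n)%N -> (stdpos n i.+1 == stdpos n z) = (i.+1 == z).
  by move=> z_range; apply/eqP/eqP=> [/(@stdpos_inj n i.+1 z (ltn_ord i))->|->].
by rewrite !stdpos_eq.
Qed.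

(** This is A = P Q P^T read entrywise. The two defining sums agree term by term, since [stdpos n]
    carries the positions of each block of Q to those of the matching pair of entries of A. *)
Lemma antidiag_mx_stdperm n (a : nat -> C) (k l : 'I_n) :
  antidiag_mx n a (stdperm n k) (stdperm n l) = quasidiag_mx n a k l.
Proof.
have elt_eq i j x y : i = stdpos n x -> j = stdpos n y ->
    (0 < x <= n)%N -> (0 < y <= n)%N ->
    elt_mx n i j (stdperm n k) (stdperm n l) = elt_mx n x y k l :> C.
  by move=> -> ->; apply: elt_mx_stdperm.
rewrite /antidiag_mx /quasidiag_mx; case: ifP => odd_n; last first.
  rewrite !summxE; apply: eq_big_nat => j /andP[j_gt0 j_le].
  rewrite !(addmxE, scalemxE).
  by congr (_ * _ + _ * _); apply: elt_eq; rewrite /stdpos; try case: eqP; lia.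
rewrite !(addmxE, scalemxE); congr (_ * _ + _).
  by apply: elt_eq; rewrite /stdpos ?odd_n /=; lia.
rewrite !summxE; apply: eq_big_nat => j /andP[j_gt0 j_le].
rewrite !(addmxE, scalemxE).
by congr (_ * _ + _ * _); apply: elt_eq; rewrite /stdpos; try case: eqP; lia.
Qed.

Lemma stdperm_mx_orthogonal n :
  stdperm_mx n *m (stdperm_mx n)^T = 1%:M :> 'M[C]_n.
Proof. by rewrite stdperm_mxE trmxK tr_perm_mx -perm_mxM mulVg perm_mx1. Qed.

Lemma stdperm_mx_real n : (stdperm_mx n : 'M[C]_n) \is a realmx.
Proof.
by apply/mxOverP => k l; rewrite stdperm_mxE !mxE realn.
Qed.

Lemma quasidiag_mxE n (a : nat -> C) :
  quasidiag_mx n a = (stdperm_mx n)^T *m antidiag_mx n a *m stdperm_mx n.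
Proof.
rewrite stdperm_mxE trmxK -row_permE tr_perm_mx -col_permE.
by apply/matrixP => k l; rewrite !mxE antidiag_mx_stdperm.
Qed.

Lemma antidiag_mxE n (a : nat -> C) :
  antidiag_mx n a = stdperm_mx n *m quasidiag_mx n a *m (stdperm_mx n)^T.
Proof.
rewrite quasidiag_mxE !mulmxA stdperm_mx_orthogonal mul1mx -mulmxA.
by rewrite stdperm_mx_orthogonal mulmx1.
Qed.

(** With the identity as twist, [eps] set to [false] or [true] gives [symmetricmx] or [skewmx], so
    (a) and (b) share one argument: transposition commutes with the congruence by [U]. *)
Lemma hermitianmx_congr n (eps : bool) (U M : 'M[C]_n) :
  M \is hermitianmx n eps idfun -> U *m M *m U^T \is hermitianmx n eps idfun.
Proof.
move=> /is_hermitianmxP ME; apply/is_hermitianmxP.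
by rewrite {1}ME !map_mx_id // !trmx_mul trmxK -scalemxAr -scalemxAl mulmxA.
Qed.

Lemma hermitian_antidiag_quasidiag n (eps : bool) (a : nat -> C) :
  antidiag_mx n a \is hermitianmx n eps idfun <->
  quasidiag_mx n a \is hermitianmx n eps idfun.
Proof.
split=> [Aherm | Qherm]; last by rewrite antidiag_mxE hermitianmx_congr.
by rewrite quasidiag_mxE -{2}[stdperm_mx n]trmxK hermitianmx_congr.
Qed.

End PermutationMatrices.

(** * Real antisymmetric quasidiagonal matrices as real Schur forms *)

Section QuasiTriangular.
Context {R : realType}.
Local Notation C := R[i].

Lemma skewmxP n (M : 'M[C]_n) :
  reflect (forall k l, M k l = - M l k) (M \is skewmx).
Proof.
apply: (iffP (is_hermitianmxP _ _ _)); rewrite expr1 scaleN1r map_mx_id //.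
  by move=> ME k l; rewrite {1}ME !mxE.
by move=> ME; apply/matrixP => k l; rewrite !mxE.
Qed.

Lemma skewmx_diag n (M : 'M[C]_n) (k : 'I_n) : M \is skewmx -> M k k = 0.
Proof.
by move=> /skewmxP/(_ k k)/eqP; rewrite -addr_eq0 -mulr2n mulrn_eq0 => /eqP.
Qed.

Lemma conj_eigenvalues_skew (B : 'M[C]_2) :
  B \is a realmx -> B \is skewmx -> B 0 1 != 0 -> conj_eigenvalues B.
Proof.
move=> /mxOverP Breal Bskew; set c := B 0 1 => c_neq0.
have c_real : c \is Num.real by apply: Breal.
have eig (z : C) : z * z = -1 -> eigenvalue B (z * c).
  (* Eigenvectors are rows: B has rows (0, c) and (-c, 0), so it sends (1, -z) to (zc, c), which is
     zc (1, -z) because z^2 = -1. *)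
  move=> zz; apply/eigenvalueP; exists (\row_j if j == 0 then 1 else - z).
    apply/rowP => j; rewrite !mxE !big_ord_recl big_ord0 !mxE /= addr0.
    have B10 : B 1 0 = - c by move/skewmxP: Bskew => ->.
    have -> : lift ord0 (ord0 : 'I_1) = 1 :> 'I_2 by apply: val_inj.
    have [->|->] : j = 0 \/ j = 1.
    - by case: j => [[|[|]]] // ?; [left|right]; apply: val_inj.
    - by rewrite skewmx_diag // B10 mulr0 add0r mulrNN mulr1.
    - rewrite skewmx_diag // -/c mulr0 mul1r addr0 mulrN mulrAC zz.
      by rewrite mulN1r opprK.
  by apply/eqP => /rowP/(_ 0); rewrite !mxE /=; apply/eqP; rewrite oner_eq0.
have conj_ic : Num.conj ('i * c : C) = (- 'i) * c.
  by rewrite rmorphM /= conjCi (conj_Creal c_real).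
exists ('i * c); split.
(* A real ic would equal its conjugate -ic, forcing 2ic = 0. *)
- rewrite CrealE conj_ic mulNr -subr_eq0 -opprD oppr_eq0 -mulr2n mulrn_eq0 /=.
  by rewrite mulf_neq0 ?neq0Ci.
- by apply: eig; rewrite -expr2 sqrCi.
- by rewrite conj_ic; apply: eig; rewrite mulrNN -expr2 sqrCi.
Qed.

(** Induction on [m], removing the leading 2 x 2 block. Indices start at 0, so [k./2] is the block
    of row [k], and the last hypothesis clears everything below the diagonal blocks. *)
Lemma quasi_triangular_skew_even m (T : 'M[C]_(m.*2)) :
  T \is a realmx -> T \is skewmx ->
  (forall k l : 'I_(m.*2), (l./2 < k./2)%N -> T k l = 0) -> quasi_triangular T.
Proof.
elim: m T => [|m IHm] T Treal Tskew Tblock; first exact: QuasiTriangular0.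
pose T' : 'M[C]_(2 + m.*2) := T; change (quasi_triangular T').
have dl0 : dlsubmx T' = 0.
  apply/matrixP => k l; rewrite !mxE; apply: Tblock => /=.
  by have := ltn_ord l; lia.
have qt_dr : quasi_triangular (drsubmx T').
  apply: IHm => [||k l lt_lk].
  - by apply/mxOverP => k l; rewrite !mxE; apply: (mxOverP Treal).
  - by apply/skewmxP => k l; rewrite !mxE; apply: (skewmxP _ Tskew).
  - by rewrite !mxE; apply: Tblock => /=; lia.
rewrite -[T']submxK dl0.
set B := ulsubmx T'.
have Breal : B \is a realmx.
  by apply/mxOverP => k l; rewrite !mxE; apply: (mxOverP Treal).
have Bskew : B \is skewmx.
  by apply/skewmxP => k l; rewrite !mxE; apply: (skewmxP _ Tskew).
have [B01|B01] := eqVneq (B 0 1) 0; last first.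
  by apply: QuasiTriangular2 qt_dr; apply: conj_eigenvalues_skew.
rewrite -dl0 submxK.
pose T1 : 'M[C]_(1 + (1 + m.*2)) := T; change (quasi_triangular T1).
(* This entry lies inside the first block, out of reach of [Tblock]; it vanishes as the opposite of
   [B 0 1]. *)
have T10 (k l : 'I_(m.+1.*2)) : k = 1%N :> nat -> l = 0%N :> nat -> T k l = 0.
  move=> k1 l0; move/skewmxP: Tskew => ->.
  suff -> : T l k = B 0 1 by rewrite B01 oppr0.
  by rewrite !mxE; congr (T _ _); apply: val_inj.
have dl1 : dlsubmx T1 = 0.
  apply/matrixP => k l; rewrite !mxE.
  have l0 : l = 0%N :> nat by have := ltn_ord l; lia.
  have [k0|k_gt0] := posnP k; first by apply: T10 => /=; lia.
  by apply: Tblock => /=; lia.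
have dl2 : dlsubmx (drsubmx T1) = 0.
  apply/matrixP => k l; rewrite !mxE; apply: Tblock => /=.
  by have := ltn_ord l; lia.
(* Removing two blocks of size 1 leaves the same tail as removing one of size 2, so the induction
   result [qt_dr] still applies. *)
have dr2 : drsubmx (drsubmx T1) = drsubmx T'.
  by apply/matrixP => k l; rewrite !mxE; congr (T _ _); apply: val_inj.
rewrite -[T1]submxK dl1; apply: QuasiTriangular1.
by rewrite -[drsubmx T1]submxK dl2 dr2; apply: QuasiTriangular1.
Qed.

(* With rows numbered from 0, (k + odd n)./2 indexes the diagonal block of [quasidiag_mx n]
   containing row k. *)
Lemma quasi_triangular_skew n (T : 'M[C]_n) :
  T \is a realmx -> T \is skewmx ->
  (forall k l : 'I_n, ((l + odd n)./2 < (k + odd n)./2)%N -> T k l = 0) ->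
  quasi_triangular T.
Proof.
have := odd_double_half n; case: (odd n); move: n./2 => m nE; last first.
  move: T; rewrite -nE add0n => T Treal Tskew Tblock.
  by apply: quasi_triangular_skew_even => // k l lt_lk; apply: Tblock; lia.
move: T; rewrite -nE -[nat_of_bool true]/1%N => T Treal Tskew Tblock.
have dl0 : dlsubmx T = 0.
  apply/matrixP => k l; rewrite !mxE; apply: Tblock => /=.
  by have := ltn_ord l; lia.
rewrite -[T]submxK dl0; apply: QuasiTriangular1.
apply: quasi_triangular_skew_even => [||k l lt_lk].
- by apply/mxOverP => k l; rewrite !mxE; apply: (mxOverP Treal).
- by apply/skewmxP => k l; rewrite !mxE; apply: (skewmxP _ Tskew).
- by rewrite !mxE; apply: Tblock => /=; lia.
Qed.

(** The row and column of each elementary matrix in the sum belong to the same diagonal block, so no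
    term reaches an entry below the blocks. *)
Lemma quasidiag_mx_eq0 n (a : nat -> C) (k l : 'I_n) :
  ((l + odd n)./2 < (k + odd n)./2)%N -> quasidiag_mx n a k l = 0.
Proof.
move=> lt_lk.
have elt0 x y : ~ (k.+1 = x /\ l.+1 = y) -> elt_mx n x y k l = 0 :> C.
  by rewrite mxE => ne; case: eqP => // ?; case: eqP => // ?; case: ne.
rewrite /quasidiag_mx; case: ifP lt_lk => odd_n lt_lk; last first.
  rewrite summxE big_nat big1 // => j /andP[j_gt0 j_le].
  by rewrite !(addmxE, scalemxE) !elt0 ?mulr0 ?addr0 //; lia.
rewrite addmxE summxE big_nat big1 ?addr0.
  by rewrite scalemxE elt0 ?mulr0 //; lia.
move=> j /andP[j_gt0 j_le].
by rewrite !(addmxE, scalemxE) !elt0 ?mulr0 ?addr0 //; lia.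
Qed.

End QuasiTriangular.

Theorem corollary4p9 (R : realType) (n : nat) (a : nat -> R[i]) :
  let A : 'M[R[i]]_n := antidiag_mx n a in
  let P : 'M[R[i]]_n := stdperm_mx n in
  let Q : 'M[R[i]]_n := quasidiag_mx n a in
  [/\ A \is symmetricmx <-> Q \is symmetricmx,
      A \is skewmx <-> Q \is skewmx
    & A \is a realmx -> A \is skewmx -> real_schur_decomposition A P Q].
Proof.
move=> A P Q; split; try exact: hermitian_antidiag_quasidiag.
move=> Areal Askew.
have Preal : P \is a realmx := stdperm_mx_real n.
have PPt : P *m P^T = 1%:M := stdperm_mx_orthogonal n.
have Qreal : Q \is a realmx.
  (* Realness is assumed of A rather than of the sequence [a]; it passes to Q because each entry of
     Q is an entry of A. *)
  apply/mxOverP => k l; rewrite /Q -antidiag_mx_stdperm; exact: (mxOverP Areal).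
have Qskew : Q \is skewmx by move/hermitian_antidiag_quasidiag: Askew.
have Qtriangular : quasi_triangular Q.
  by apply: (quasi_triangular_skew Qreal Qskew) => k l; apply: quasidiag_mx_eq0.
have PV : invmx P = P^T.
  have /mulmx1_unit[P_unit _] := PPt.
  by rewrite -[LHS]mulmx1 -PPt mulmxA mulVmx // mul1mx.
split; [exact: Areal | split; [exact: Preal | exact: PPt]
       | split; [exact: Qreal | exact: Qtriangular] |].
by rewrite PV; apply: antidiag_mxE.
Qed.
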